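(* Let $X$ and $Y$ be compact Hausdorff spaces, and let $A$ and $B$ be sublattices of $C(X,I)$ and $C(Y,I)$, respectively, which are closed under (pointwise) multiplication and have Urysohn's property. Assume, furthermore, that the evaluation of $A$ on $X$ and the evaluation of $B$ on $Y$ are dense in $I$. Then for any lattice isomorphism $\varphi:A\longrightarrow B$ the following statements are equivalent: (i) $\varphi$ is a homeomorphism with respect to the uniform convergence topologies on $A$ and $B$. (ii) $\varphi$ is strictly increasing in both directions, i.e. for all $f,g\in A$, $f<g$ if and only if $\varphi(f)<\varphi(g)$. (iii) There are a homeomorphism $\mu:Y\longrightarrow X$ and a family $\{m_y\}_{y\in Y}$ of strictly increasing continuous bijections $m_y:I\longrightarrow I$ such that $\varphi(f)(y)=m_y(f(\mu(y)))$ for all $y\in Y$ and all $f\in A$.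
   Context: $I=[0,1]$. For a compact Hausdorff space $X$, $C(X,I)$ is the lattice of all continuous functions $X\to I$, with $f\vee g=\max(f,g)$ and $f\wedge g=\min(f,g)$ pointwise; a sublattice is a subset closed under $\vee$ and $\wedge$ (it need not contain all constants). A lattice isomorphism $\varphi:A\to B$ is a bijection with $\varphi(f\wedge g)=\varphi(f)\wedge\varphi(g)$ and $\varphi(f\vee g)=\varphi(f)\vee\varphi(g)$ for all $f,g\in A$. A subset $A\subseteq C(X,I)$ has Urysohn's property if for any pair of disjoint closed subsets $F,G$ of $X$ (the empty set is allowed) there exists $f\in A$ with $f=0$ on $F$ and $f=1$ on $G$. The evaluation of $A$ on $X$ is dense in $I$ if for each $x\in X$ the set $A_x=\{f(x):f\in A\}$ is dense in $I$. For functions, $f<g$ means $f(x)<g(x)$ at every point $x$ of the domain. *)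

(* Defs.v *)
From mathcomp Require Import all_boot all_order all_algebra.
From mathcomp Require Import all_classical all_reals all_analysis.

Set Implicit Arguments.
Unset Strict Implicit.
Unset Printing Implicit Defensive.

Import Order.TTheory GRing.Theory Num.Theory.
Import numFieldNormedType.Exports.

Local Open Scope classical_set_scope.
Local Open Scope ring_scope.

(* Elements of C(X, I) are represented as real-valued continuous functions with
   values in [0, 1]. *)
Definition CI {R : realType} {X : topologicalType} : set (X -> R) :=
  [set f : X -> R | continuous f /\ forall x, 0 <= f x <= 1].

Definition sublattice {R : realType} {X : topologicalType} (A : set (X -> R)) :=
  [/\ A `<=` CI,
      forall f g, A f -> A g -> A (f \max g) &
      forall f g, A f -> A g -> A (f \min g)].

Definition mul_closed {R : realType} {X : Type} (A : set (X -> R)) :=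
  forall f g, A f -> A g -> A (f \* g).

Definition urysohn_property {R : realType} {X : topologicalType}
    (A : set (X -> R)) :=
  forall F G : set X, closed F -> closed G -> F `&` G = set0 ->
  exists f, [/\ A f, forall x, F x -> f x = 0 & forall x, G x -> f x = 1].

(* For a subset of I, density in I means that its closure contains I. *)
Definition dense_evaluation {R : realType} {X : Type} (A : set (X -> R)) :=
  forall x, `[0, 1] `<=` closure [set f x | f in A].

(* A map A -> B is represented by a total function of which only the values on
   A matter. *)
Definition lattice_isomorphism {R : realType} {X Y : Type}
    (A : set (X -> R)) (B : set (Y -> R)) (phi : (X -> R) -> (Y -> R)) :=
  [/\ set_bij A B phi,
      forall f g, A f -> A g -> phi (f \min g) = phi f \min phi g &
      forall f g, A f -> A g -> phi (f \max g) = phi f \max phi g].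

Definition homeomorphism {T U : topologicalType} (f : T -> U) :=
  exists g : U -> T,
    [/\ cancel f g, cancel g f, continuous f & continuous g].

(* f restricts to a homeomorphism from A onto B, for the subspace topologies;
   g is a total extension of the inverse B -> A. *)
Definition homeomorphism_on {T U : topologicalType} (A : set T) (B : set U)
    (f : T -> U) :=
  set_bij A B f /\
  exists g : U -> T,
    [/\ forall x, A x -> g (f x) = x,
        {within A, continuous f} & {within B, continuous g}].

Definition uniform_homeomorphism {R : realType} {X Y : topologicalType}
    (A : set (X -> R)) (B : set (Y -> R)) (phi : (X -> R) -> (Y -> R)) :=
  @homeomorphism_on {uniform X -> R} {uniform Y -> R} A B phi.

Definition increasing_bijection_I {R : realType} (m : R -> R) :=
  [/\ set_bij `[0, 1] `[0, 1] m,
      {in `[0 : R, 1] &, {homo m : s t / s < t}} &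
      {within `[0, 1], continuous m}].

(* Main.v *)
Require Import Defs.
From mathcomp Require Import all_boot all_order all_algebra.
From mathcomp Require Import all_classical all_reals all_analysis.
From mathcomp Require Import lra.

Set Implicit Arguments.
Unset Strict Implicit.
Unset Printing Implicit Defensive.

Import Order.TTheory GRing.Theory Num.Theory.
Import numFieldNormedType.Exports.

Local Open Scope classical_set_scope.
Local Open Scope ring_scope.

(** Any lattice isomorphism [phi] from [A] onto [B], with inverse [psi], moves
    points: each [y] has a point [mu y] such that [phi f y] is monotone in the
    germ of [f] at [mu y] ([local_along], proved in [iso_local]).  The point is
    found as in Kaplansky's theorem: the functions [f] with [phi f y = 0] form
    a proper prime ideal of [A], and by compactness this ideal contains all
    functions that vanish near some common point.  Bump functions from
    Urysohn's property turn this into monotonicity in germs, into continuity of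
    [mu], and into the fact that [mu] and the analogous map [nu] for [psi] are
    inverse homeomorphisms.

    Germs cannot be replaced by values in general: [f (mu y) < g (mu y)] only
    gives [phi f y <= phi g y].  For instance [phi f y = f y `^ y] on [0, 1],
    defined on the [f] for which this extends continuously to [y = 0], gives
    the value 1 at 0 to every [f] with [f 0 > 0].  Each of the three conditions
    of the theorem is equivalent to strictness ([strict_along]) of both [phi]
    and [psi]: [f (mu y) < g (mu y)] implies [phi f y < phi g y].
    - If [phi] preserves the everywhere strict order, then modifying [f] and
      [g] away from [mu y] makes [f < g] hold everywhere without changing the
      germs, so [phi] is strict ([strict_along_of_increasing]).
    - If [psi] is continuous and [phi g y <= phi f y], then [phi f] can be
      raised by less than any given amount, near [y] only, so as to dominate
      [phi g] near [y]; hence [g (mu y) <= f (mu y)]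
      ([strict_along_of_sup_continuous]).
    - Conversely, strictness makes [f (mu y) |-> phi f y] a well-defined strictly
      increasing map between dense subsets of the unit interval, which extends
      to the required bijection ([dense_order_extension]).
    - Strictness also gives continuity: by density [phi f y] is squeezed between
      [phi g1 y] and [phi g2 y] with [g1 (mu y) < f (mu y) < g2 (mu y)], and
      this persists for all functions close to [f] and all points close to [y];
      compactness of [Y] makes it uniform ([strict_along_sup_continuous]). *)

(** * Lattices with Urysohn's property and their isomorphisms *)

Record separating_lattice (R : realType) (X : topologicalType)
    (A : set (X -> R)) : Prop := SeparatingLattice {
  sep_compact : compact [set: X];
  sep_hausdorff : hausdorff_space X;
  sep_sublattice : sublattice A;
  sep_urysohn : urysohn_property A }.

(** An isomorphism is carried together with its inverse so that every statement
    about [phi] also applies to [psi]. *)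
Record inverse_lattice_isos (R : realType) (X Y : topologicalType)
    (A : set (X -> R)) (B : set (Y -> R))
    (phi : (X -> R) -> (Y -> R)) (psi : (Y -> R) -> (X -> R)) : Prop :=
  InverseLatticeIsos {
  iso_image : forall f, A f -> B (phi f);
  iso_preimage : forall g, B g -> A (psi g);
  iso_cancel : forall f, A f -> psi (phi f) = f;
  iso_cancelV : forall g, B g -> phi (psi g) = g;
  iso_min : forall f g, A f -> A g -> phi (f \min g) = phi f \min phi g;
  iso_max : forall f g, A f -> A g -> phi (f \max g) = phi f \max phi g;
  iso_minV : forall f g, B f -> B g -> psi (f \min g) = psi f \min psi g;
  iso_maxV : forall f g, B f -> B g -> psi (f \max g) = psi f \max psi g }.

Lemma inverse_lattice_isos_sym (R : realType) (X Y : topologicalType)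
    (A : set (X -> R)) (B : set (Y -> R)) phi psi :
  inverse_lattice_isos A B phi psi -> inverse_lattice_isos B A psi phi.
Proof. by case=> *; split. Qed.

Lemma lattice_isomorphism_inverse (R : realType) (X Y : topologicalType)
    (A : set (X -> R)) (B : set (Y -> R)) phi :
  sublattice A -> sublattice B -> lattice_isomorphism A B phi ->
  exists psi, inverse_lattice_isos A B phi psi.
Proof.
move=> [_ maxA minA] [_ maxB minB] [bijphi phimin phimax].
pose psi := pinv_ (fun=> (fun=> 0) : X -> R) A phi.
have [hphi injphi surphi] := bijphi.
have psiA g : B g -> A (psi g).
  by have [h _ _] := bijpinv_bij (fun=> (fun=> 0) : X -> R) bijphi; apply: h.
have psiK f : A f -> psi (phi f) = f.
  by move=> Af; apply: pinvKV => //; rewrite inE.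
have phiK g : B g -> phi (psi g) = g.
  by move=> /surphi imBg; apply: pinvK; rewrite inE.
exists psi; split => // f g Bf Bg.
- rewrite -{1}(phiK f Bf) -{1}(phiK g Bg) -phimin ?psiK //;
    by [apply: minA; apply: psiA | apply: psiA].
- rewrite -{1}(phiK f Bf) -{1}(phiK g Bg) -phimax ?psiK //;
    by [apply: maxA; apply: psiA | apply: psiA].
Qed.

Section SeparatingLatticeTheory.
Context (R : realType) (X : topologicalType) (A : set (X -> R)).
Hypothesis sepA : separating_lattice A.

Lemma sep_continuous f : A f -> continuous f.
Proof. by have [AC _ _] := sep_sublattice sepA => /AC[]. Qed.

Lemma sep_ge0 f x : A f -> 0 <= f x.
Proof. by have [AC _ _] := sep_sublattice sepA => /AC[_ /(_ x)/andP[]]. Qed.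

Lemma sep_le1 f x : A f -> f x <= 1.
Proof. by have [AC _ _] := sep_sublattice sepA => /AC[_ /(_ x)/andP[]]. Qed.

Lemma sep_max f g : A f -> A g -> A (f \max g).
Proof. by have [_ h _] := sep_sublattice sepA; exact: h. Qed.

Lemma sep_min f g : A f -> A g -> A (f \min g).
Proof. by have [_ _ h] := sep_sublattice sepA; exact: h. Qed.

Lemma sep_cst0 : A (cst 0).
Proof.
have [|f [Af f0 _]] := sep_urysohn sepA closedT closed0; first by rewrite setI0.
by have <- : f = cst 0 by apply/funext => x; rewrite f0.
Qed.

Lemma sep_cst1 : A (cst 1).
Proof.
have [|f [Af _ f1]] := sep_urysohn sepA closed0 closedT; first by rewrite set0I.
by have <- : f = cst 1 by apply/funext => x; rewrite f1.
Qed.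

Lemma sep_regular (x : X) : {for x, regular_space X}.
Proof.
exact: compact_regular (sep_hausdorff sepA) (sep_compact sepA) filterT.
Qed.

(** Regularity is used to fatten the point [x]: a bump function then has
    prescribed values on a whole neighbourhood of [x], which is what conditions
    on germs require. *)
Lemma sep_closed_pair (x : X) (U : set X) : nbhs x U ->
  exists F G : set X,
    [/\ closed F, closed G, F `&` G = set0, nbhs x F & ~` U `<=` G].
Proof.
move=> /nbhs_interior/(sep_regular)[V nV VU].
exists (closure V), (~` U°); split.
- exact: closed_closure.
- by apply: open_closedC; apply: open_interior.
- by apply/seteqP; split => // z [/VU].
- by apply: filterS nV; exact: subset_closure.
- by apply: subsetC; exact: interior_subset.
Qed.

Lemma sep_bump0 (x : X) (U : set X) : nbhs x U ->
  exists k, [/\ A k, \forall z \near x, k z = 0 & forall z, ~ U z -> k z = 1].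
Proof.
move=> /sep_closed_pair[F [G [cF cG FG0 nF UG]]].
have [k [Ak k0 k1]] := sep_urysohn sepA cF cG FG0.
by exists k; split=> // [|z /UG/k1//]; apply: filterS nF.
Qed.

Lemma sep_bump1 (x : X) (U : set X) : nbhs x U ->
  exists k, [/\ A k, \forall z \near x, k z = 1 & forall z, ~ U z -> k z = 0].
Proof.
move=> /sep_closed_pair[F [G [cF cG FG0 nF UG]]].
rewrite setIC in FG0.
have [k [Ak k0 k1]] := sep_urysohn sepA cG cF FG0.
by exists k; split=> // [|z /UG/k0//]; apply: filterS nF.
Qed.

End SeparatingLatticeTheory.

Lemma near_lt_continuous (R : realType) (X : topologicalType) (f g : X -> R) x :
  {for x, continuous f} -> {for x, continuous g} -> f x < g x ->
  \forall z \near x, f z < g z.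
Proof.
move=> cf cg fg.
have cgf : (fun z => g z - f z) @ x --> g x - f x by apply: cvgB.
move: fg; rewrite -subr_gt0 => /(cvgr_gt _ cgf).
by apply: filterS => z; rewrite subr_gt0.
Qed.

(** * The point map of an isomorphism *)

Section IsoTheory.
Context (R : realType) (X Y : topologicalType).
Context (A : set (X -> R)) (B : set (Y -> R)).
Context (phi : (X -> R) -> (Y -> R)) (psi : (Y -> R) -> (X -> R)).
Hypothesis sepA : separating_lattice A.
Hypothesis sepB : separating_lattice B.
Hypothesis iso : inverse_lattice_isos A B phi psi.

Lemma iso_le f g y : A f -> A g -> (forall x, f x <= g x) -> phi f y <= phi g y.
Proof.
move=> Af Ag fg; have {1}-> : f = f \min g.
  by apply/funext => x /=; apply/esym/min_idPl.
by rewrite (iso_min iso) //= ge_min lexx orbT.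
Qed.

Lemma iso_cst0 y : phi (cst 0) y = 0.
Proof.
have B0 := sep_cst0 sepB; have A0 := sep_cst0 sepA.
apply/eqP; rewrite eq_le (sep_ge0 sepB) ?andbT; last exact: iso_image iso _ _.
rewrite -[leRHS]/((cst 0 : Y -> R) y) -(iso_cancelV iso B0).
apply: iso_le => // [|x]; first exact: iso_preimage iso _ _.
by rewrite (sep_ge0 sepA) //; exact: iso_preimage iso _ _.
Qed.

Lemma iso_cst1 y : phi (cst 1) y = 1.
Proof.
have B1 := sep_cst1 sepB; have A1 := sep_cst1 sepA.
apply/eqP; rewrite eq_le (sep_le1 sepB) ?andTb; last exact: iso_image iso _ _.
rewrite -[leLHS]/((cst 1 : Y -> R) y) -(iso_cancelV iso B1).
apply: iso_le => // [|x]; first exact: iso_preimage iso _ _.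
by rewrite (sep_le1 sepA) //; exact: iso_preimage iso _ _.
Qed.

(** If every point [x] had a function vanishing near [x] whose image does not
    vanish at [y], then finitely many of these would have minimum 0; but a
    minimum of functions with [phi f y <> 0] has the same property, since [phi]
    preserves minima. *)
Lemma iso_support_point y :
  exists x : X, forall k, A k -> (\forall z \near x, k z = 0) -> phi k y = 0.
Proof.
apply: contrapT => nox.
(* The finite subcover is hidden in a filter: a statement holds eventually when
   it holds for all functions below some [f] with [phi f y <> 0], and compactness
   is applied to the property [h x <= 0] along this filter. *)
pose D := [set f | A f /\ phi f y <> 0].
pose below (f : X -> R) := [set h : X -> R | forall z, h z <= f z].
have FF : Filter (filter_from D below).
  apply: filter_from_filter.
    exists (cst 1); split; first exact: sep_cst1.
    by rewrite iso_cst1; apply/eqP; rewrite oner_eq0.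
  move=> f g [Af f0] [Ag g0]; exists (f \min g).
    split; first exact: sep_min.
    by rewrite (iso_min iso) //= minElt; case: ifP.
  by move=> h hfg; split=> z; have := hfg z; rewrite /= le_min => /andP[].
have := sep_compact sepA; rewrite compact_near_coveringP.
move=> /(_ _ _ (fun (h : X -> R) x => h x <= 0) FF)[|f [Af f0] /(_ f) fle0].
  move=> x _.
  have [k [Ak nk k0]] : exists k, [/\ A k, \forall z \near x, k z = 0 & phi k y <> 0].
    apply: contrapT => nok; apply: nox; exists x => k Ak nk.
    by apply: contrapT => k0; apply: nok; exists k.
  exists ([set z | k z = 0], below k) => /=; first by split=> //; exists k.
  by move=> [z h] /= [<-]; apply.
apply: f0; rewrite -[RHS](iso_cst0 y); congr (phi _ y).
apply/funext => x; apply/eqP; rewrite eq_le (sep_ge0 sepA) // andbT.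
by apply: fle0 => //=; rewrite /below /=.
Qed.

Definition local_along (mu : Y -> X) := forall y f g, A f -> A g ->
  (\forall z \near mu y, f z <= g z) -> phi f y <= phi g y.

(** If [f <= g] on a neighbourhood [U] of [mu y], and [k] vanishes near [mu y] and
    equals 1 off [U], then [f <= g \max k] everywhere, while [phi k y = 0]. *)
Lemma iso_local : exists mu, local_along mu.
Proof.
have [mu muP] := choice iso_support_point.
exists mu => y f g Af Ag fg.
have [k [Ak k0 k1]] := sep_bump0 sepA fg.
have : phi f y <= phi (g \max k) y.
  apply: iso_le => //; first exact: sep_max.
  move=> z /=; have [fgz|/k1 ->] := pselect (f z <= g z); first by rewrite le_max fgz.
  by rewrite le_max (sep_le1 sepA) ?orbT.
rewrite (iso_max iso) //= (muP y k) // => h; apply: le_trans h _.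
by rewrite ge_max lexx (sep_ge0 sepB) //; exact: iso_image iso _ _.
Qed.

(** If [k] vanishes near [mu y] and equals 1 off a small neighbourhood [V], then
    [phi k] is 0 at [y], hence below 1 near [y]; but [phi k y' = 1] as soon as
    [mu y'] lies outside the closure of [V]. *)
Lemma local_along_continuous mu : local_along mu -> continuous mu.
Proof.
move=> loc y U /(sep_regular sepA)[V nV VU].
have [k [Ak k0 k1]] := sep_bump0 sepA nV.
have phik0 : phi k y <= 0.
  rewrite -(iso_cst0 y); apply: loc => //; first exact: sep_cst0.
  by apply: filterS k0 => z ->.
have cphik : {for y, continuous (phi k)}.
  by apply: (sep_continuous sepB); exact: iso_image iso _ _.
have : phi k y < 1 by apply: le_lt_trans phik0 _.
move=> /(cvgr_lt _ cphik); apply: filterS => y' phik1; apply: VU.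
apply: contrapT => nV'; move: phik1; apply/negP; rewrite -leNgt.
rewrite -(iso_cst1 y'); apply: loc => //; first exact: sep_cst1.
have : nbhs (mu y') (~` closure V).
  by apply: open_nbhs_nbhs; split=> //; apply: closed_openC; apply: closed_closure.
by apply: filterS => z /= nVz; rewrite k1// => /(@subset_closure _ V).
Qed.

Definition strict_along (mu : Y -> X) := forall y f g, A f -> A g ->
  f (mu y) < g (mu y) -> phi f y < phi g y.

(** Cutting [f] down to 0 and raising [g] to 1 away from [mu y] leaves their
    germs at [mu y] unchanged and makes the strict inequality global. *)
Lemma strict_along_of_increasing mu : local_along mu ->
  (forall f g, A f -> A g -> (forall x, f x < g x) ->
     forall y, phi f y < phi g y) ->
  strict_along mu.
Proof.
move=> loc inc y f g Af Ag fg.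
have nU := near_lt_continuous (@sep_continuous _ _ _ sepA f Af (mu y))
  (@sep_continuous _ _ _ sepA g Ag (mu y)) fg.
have [k0 [Ak0 k00 k01]] := sep_bump0 sepA nU.
have [k1 [Ak1 k11 k10]] := sep_bump1 sepA nU.
have Af' : A (f \min k1) by exact: sep_min.
have Ag' : A (g \max k0) by exact: sep_max.
apply: (@le_lt_trans _ _ (phi (f \min k1) y)).
  apply: loc => //; apply: filterS k11 => z /= ->.
  by rewrite le_min lexx (sep_le1 sepA).
apply: (@lt_le_trans _ _ (phi (g \max k0) y)); last first.
  apply: loc => //; apply: filterS k00 => z /= ->.
  by rewrite ge_max lexx (sep_ge0 sepA).
apply: inc => // z /=; have [fgz|nfg] := pselect (f z < g z).
  by rewrite gt_min lt_max fgz.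
by rewrite k10 ?k01// gt_min !lt_max ltr01 !orbT.
Qed.

End IsoTheory.
Section LocalInverse.
Context (R : realType) (X Y : topologicalType).
Context (A : set (X -> R)) (B : set (Y -> R)).
Context (phi : (X -> R) -> (Y -> R)) (psi : (Y -> R) -> (X -> R)).
Context (mu : Y -> X) (nu : X -> Y).
Hypothesis sepA : separating_lattice A.
Hypothesis sepB : separating_lattice B.
Hypothesis iso : inverse_lattice_isos A B phi psi.
Hypothesis locphi : local_along A phi mu.
Hypothesis locpsi : local_along B psi nu.

(** If [nu (mu y)] differs from [y], take [h] vanishing near [nu (mu y)] with
    [h y = 1]. Then [psi h] vanishes near [mu y], so [h = phi (psi h)] vanishes
    at [y]. *)
Lemma local_along_cancel : cancel mu nu.
Proof.
have isoV := inverse_lattice_isos_sym iso.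
move=> y; apply: contrapT => /eqP neq.
have nU : nbhs (nu (mu y)) (~` [set y]).
  apply: open_nbhs_nbhs; split; last by move=> /= /eqP; apply/negP.
  apply: closed_openC; apply: accessible_closed_set1.
  by apply: hausdorff_accessible; exact: sep_hausdorff sepB.
have [h [Bh h0 h1]] := sep_bump0 sepB nU.
have hy : h y = 1 by apply: h1 => /(_ erefl).
have nuc := local_along_continuous sepB sepA isoV locpsi.
have psih0 : \forall x \near mu y, psi h x <= (cst 0 : X -> R) x.
  have hnu : \forall x \near mu y, \forall w \near nu x, h w = 0.
    exact: nuc (nbhs_interior h0).
  apply: filterS hnu => x hx.
  rewrite -(iso_cst0 sepB sepA isoV x); apply: locpsi => //.
    exact: sep_cst0.
  by apply: filterS hx => z ->.
have : phi (psi h) y <= phi (cst 0) y.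
  by apply: locphi => //; [exact: iso_preimage iso _ _|exact: sep_cst0].
by rewrite (iso_cancelV iso) // (iso_cst0 sepA sepB iso) hy ler10.
Qed.

End LocalInverse.

(** * Continuity for the uniform convergence topologies *)

Definition sup_continuous_on (R : realType) (X Y : Type) (A : set (X -> R))
    (phi : (X -> R) -> (Y -> R)) :=
  forall f, A f -> forall e, 0 < e -> exists2 d, 0 < d &
    forall h, A h -> (forall x, `|f x - h x| < d) ->
      forall y, `|phi f y - phi h y| < e.

Lemma within_uniform_continuousP (R : realType) (X Y : topologicalType)
   (A : set (X -> R)) (phi : (X -> R) -> (Y -> R)) :
  {within (A : set {uniform X -> R}),
     continuous (phi : {uniform X -> R} -> {uniform Y -> R})} <->
  sup_continuous_on A phi.
Proof.
split=> [/subspace_continuousP cphi f Af e e0|cphi].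
  have nE : nbhs (phi f : {uniform Y -> R}) [set h | forall y, `|phi f y - h y| < e].
    apply/uniform_nbhs; exists [set xy | `|xy.1 - xy.2| < e]; split.
      by rewrite -entourage_ballE; exists e => // -[a b] /=; rewrite -ball_normE.
    by move=> h /= hE y; exact: hE.
  have := cphi f Af _ nE; rewrite /= /within /=.
  move=> /uniform_nbhs[E []]; rewrite -entourage_ballE => -[d /= d0 dE] EP.
  exists d => // h Ah hd; apply: EP => //= x _.
  by apply: dE => /=; rewrite -ball_normE /=; apply: hd.
apply/subspace_continuousP => f Af P /uniform_nbhs.
move=> [E []]; rewrite -entourage_ballE => -[e /= e0 eE] EP.
have [d d0 dP] := cphi f Af e e0.
apply/uniform_nbhs; exists [set xy | `|xy.1 - xy.2| < d]; split.
  by rewrite -entourage_ballE; exists d => // -[a b] /=; rewrite -ball_normE.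
move=> h /= hd Ah; apply: EP => /= y _; apply: eE.
by rewrite /= -ball_normE /=; apply: dP => // x; exact: hd.
Qed.

(** * Strictness and continuity *)

Section StrictAlong.
Context (R : realType) (X Y : topologicalType).
Context (A : set (X -> R)) (B : set (Y -> R)).
Context (phi : (X -> R) -> (Y -> R)) (psi : (Y -> R) -> (X -> R)).
Context (mu : Y -> X) (nu : X -> Y).
Hypothesis sepA : separating_lattice A.
Hypothesis sepB : separating_lattice B.
Hypothesis iso : inverse_lattice_isos A B phi psi.
Hypothesis locphi : local_along A phi mu.
Hypothesis locpsi : local_along B psi nu.

(** If [phi g y <= phi f y], then for any [d > 0] the function [h] equal to
    [phi f], raised to [phi g] near [y] by means of a bump function, is within
    [d] of [phi f].  As [phi g <= h] near [y], the value of [psi h] at [mu y] is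
    at least [g (mu y)]; continuity of [psi] at [phi f] brings it below
    [g (mu y)] when [f (mu y) < g (mu y)]. *)
Lemma strict_along_of_sup_continuous :
  sup_continuous_on B psi -> strict_along A phi mu.
Proof.
move=> cpsi y f g Af Ag fg; rewrite ltNge; apply/negP => gf.
have Bf := iso_image iso Af; have Bg := iso_image iso Ag.
have e0 : 0 < g (mu y) - f (mu y) by rewrite subr_gt0.
have [d d0 dP] := cpsi _ Bf _ e0.
have nU : \forall z \near y, phi g z < phi f z + d.
  apply: near_lt_continuous; first exact: (sep_continuous sepB).
    by apply: cvgD; [exact: (sep_continuous sepB)|exact: cvg_cst].
  by apply: le_lt_trans gf _; rewrite ltrDl.
have [k [Bk k1 k0]] := sep_bump1 sepB nU.
pose h := phi f \max (phi g \min k).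
have Bh : B h by apply: (sep_max sepB) => //; apply: (sep_min sepB).
have hd z : `|phi f z - h z| < d.
  have hf : phi f z <= h z by rewrite /h /= le_max lexx.
  rewrite distrC ger0_norm ?subr_ge0 // ltrBlDl /h /= gt_max ltrDl d0 /= gt_min.
  have [->//|/k0 ->] := pselect (phi g z < phi f z + d).
  by apply/orP; right; apply: ltr_wpDl => //; exact: (sep_ge0 sepB).
have := dP h Bh hd (mu y).
rewrite (iso_cancel iso) // distrC => /(le_lt_trans (ler_norm _)).
apply/negP; rewrite -leNgt lerD2r -{1}(iso_cancel iso Ag).
apply: locpsi => //; rewrite (local_along_cancel sepA sepB iso locphi locpsi).
apply: filterS k1 => z kz; rewrite /h /= kz le_max orbC le_min lexx.
by rewrite (sep_le1 sepB).
Qed.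

Hypothesis strphi : strict_along A phi mu.
Hypothesis strpsi : strict_along B psi nu.

Lemma strict_along_lt y f g : A f -> A g ->
  (phi f y < phi g y) = (f (mu y) < g (mu y)).
Proof.
move=> Af Ag; apply/idP/idP; last exact: strphi.
have muK := local_along_cancel sepA sepB iso locphi locpsi.
rewrite -{2}(iso_cancel iso Af) -{2}(iso_cancel iso Ag) -{1 2}(muK y).
by apply: strpsi; exact: iso_image iso _ _.
Qed.

End StrictAlong.

Lemma dense_between (R : realType) (X : Type) (A : set (X -> R)) x s t :
  dense_evaluation A -> 0 <= s -> s < t -> t <= 1 ->
  exists f, A f /\ s < f x < t.
Proof.
move=> dA s0 st t1.
have : closure [set f x | f in A] ((s + t) / 2).
  by apply: dA; rewrite /= in_itv /=; lra.
move=> /(_ `]s, t[%classic) []; last first.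
  by move=> _ [[f Af <-]] /=; rewrite in_itv /= => h; exists f.
by apply: near_in_itvoo; rewrite in_itv /=; lra.
Qed.

Section StrictContinuity.
Context (R : realType) (X Y : topologicalType).
Context (A : set (X -> R)) (B : set (Y -> R)).
Context (phi : (X -> R) -> (Y -> R)) (psi : (Y -> R) -> (X -> R)).
Context (mu : Y -> X) (nu : X -> Y).
Hypothesis sepA : separating_lattice A.
Hypothesis sepB : separating_lattice B.
Hypothesis iso : inverse_lattice_isos A B phi psi.
Hypothesis locphi : local_along A phi mu.
Hypothesis locpsi : local_along B psi nu.
Hypothesis strphi : strict_along A phi mu.
Hypothesis strpsi : strict_along B psi nu.
Hypothesis denseB : dense_evaluation B.

Let cphi f : A f -> continuous (phi f).
Proof. by move=> Af; apply: (sep_continuous sepB); exact: iso_image iso _ _. Qed.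

Let cmu f : A f -> continuous (f \o mu).
Proof.
move=> Af y; apply: continuous_comp.
  exact: (local_along_continuous sepA sepB iso locphi).
exact: (sep_continuous sepA).
Qed.

(** Density of [B] at [y] provides [g] in [B] with [phi f y < g y < phi f y + e].
    Strictness of [psi] gives [f (mu y) < psi g (mu y)], and for [h] close to
    [f] and [y'] near [y] strictness of [phi] gives [phi h y' < g y']. When
    [phi f y = 1] no such [g] exists, but then 1 itself is the bound. *)
Lemma strict_along_usc f (e : R) (y : Y) : A f -> 0 < e ->
  \forall y' \near y & d \near 0^'+, forall h, A h ->
    (forall x, h x < f x + d) -> phi h y' < phi f y' + e.
Proof.
move=> Af e0; have [f1|f1] := ltP (phi f y) 1; last first.
  have nV : \forall y' \near y, 1 < phi f y' + e.
    apply: near_lt_continuous; first exact: cvg_cst.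
      by apply: cvgD; [exact: cphi|exact: cvg_cst].
    by apply: le_lt_trans f1 _; rewrite ltrDl.
  exists ([set y' | 1 < phi f y' + e], setT) => /=.
    by split=> //; exact: filterT.
  move=> [y' d] /= [V _] h Ah _; apply: le_lt_trans V.
  by apply: (sep_le1 sepB); exact: iso_image iso _ _.
have Bf := iso_image iso Af.
have [|||g [Bg /andP[fg ge]]] :=
    @dense_between _ _ B y (phi f y) (Num.min 1 (phi f y + e)) denseB _ _ _.
- exact: (sep_ge0 sepB).
- by rewrite lt_min f1 ltrDl.
- by rewrite ge_min lexx.
move: ge; rewrite lt_min => /andP[_ ge].
have Ag := iso_preimage iso Bg.
have fg' : f (mu y) < psi g (mu y).
  by rewrite -(strict_along_lt sepA sepB iso locphi locpsi) // (iso_cancelV iso).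
pose d0 := (psi g (mu y) - f (mu y)) / 2.
have d00 : 0 < d0 by rewrite divr_gt0 // subr_gt0.
have nV : \forall y' \near y, f (mu y') + d0 < psi g (mu y').
  apply: near_lt_continuous; last by rewrite /d0; lra.
    by apply: cvgD; [exact: (cmu Af)|exact: cvg_cst].
  exact: (cmu Ag).
have nW : \forall y' \near y, g y' < phi f y' + e.
  apply: near_lt_continuous => //; first exact: (sep_continuous sepB).
  by apply: cvgD; [exact: cphi|exact: cvg_cst].
exists ([set y' | f (mu y') + d0 < psi g (mu y') /\ g y' < phi f y' + e],
    [set d | d < d0]) => /=.
  by split; [exact: filterI|exact: nbhs_right_lt].
move=> [y' d] /= [[V W] dd0] h Ah hd; apply: lt_trans W.
rewrite -[X in _ < X y'](iso_cancelV iso Bg); apply: strphi => //.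
apply: lt_trans (hd _) _; apply: lt_trans V; by rewrite ltrD2l.
Qed.

(** The mirror image of [strict_along_usc], with 0 as the exceptional value. *)
Lemma strict_along_lsc f (e : R) (y : Y) : A f -> 0 < e ->
  \forall y' \near y & d \near 0^'+, forall h, A h ->
    (forall x, f x < h x + d) -> phi f y' < phi h y' + e.
Proof.
move=> Af e0; have [f0|f0] := ltP 0 (phi f y); last first.
  have nV : \forall y' \near y, phi f y' < e.
    apply: near_lt_continuous; [exact: cphi|exact: cvg_cst|].
    exact: le_lt_trans f0 _.
  exists ([set y' | phi f y' < e], setT) => /=.
    by split=> //; exact: filterT.
  move=> [y' d] /= [V _] h Ah _; apply: lt_le_trans V _.
  by rewrite lerDr; apply: (sep_ge0 sepB); exact: iso_image iso _ _.
have Bf := iso_image iso Af.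
have [|||g [Bg /andP[ge fg]]] :=
    @dense_between _ _ B y (Num.max 0 (phi f y - e)) (phi f y) denseB _ _ _.
- by rewrite le_max lexx.
- by rewrite gt_max f0 gtrBl.
- exact: (sep_le1 sepB).
move: ge; rewrite gt_max => /andP[_ ge].
have Ag := iso_preimage iso Bg.
have fg' : psi g (mu y) < f (mu y).
  by rewrite -(strict_along_lt sepA sepB iso locphi locpsi) // (iso_cancelV iso).
pose d0 := (f (mu y) - psi g (mu y)) / 2.
have d00 : 0 < d0 by rewrite divr_gt0 // subr_gt0.
have nV : \forall y' \near y, psi g (mu y') + d0 < f (mu y').
  apply: near_lt_continuous; last by rewrite /d0; lra.
    by apply: cvgD; [exact: (cmu Ag)|exact: cvg_cst].
  exact: (cmu Af).
have nW : \forall y' \near y, phi f y' < g y' + e.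
  apply: near_lt_continuous; [exact: cphi| |by rewrite -ltrBlDr].
  by apply: cvgD; [exact: (sep_continuous sepB)|exact: cvg_cst].
exists ([set y' | psi g (mu y') + d0 < f (mu y') /\ phi f y' < g y' + e],
    [set d | d < d0]) => /=.
  by split; [exact: filterI|exact: nbhs_right_lt].
move=> [y' d] /= [[V W] dd0] h Ah hd; apply: lt_trans W _.
rewrite ltrD2r -[X in X y' < _](iso_cancelV iso Bg); apply: strphi => //.
have := hd (mu y'); lra.
Qed.

Lemma strict_along_sup_continuous : sup_continuous_on A phi.
Proof.
move=> f Af e e0.
have := sep_compact sepB; rewrite compact_near_coveringP => cov.
have P1 : \forall d \near 0^'+, forall y, [set: Y] y -> forall h, A h ->
    (forall x, h x < f x + d) -> phi h y < phi f y + e.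
  by apply: cov => y _; exact: strict_along_usc.
have P2 : \forall d \near 0^'+, forall y, [set: Y] y -> forall h, A h ->
    (forall x, f x < h x + d) -> phi f y < phi h y + e.
  by apply: cov => y _; exact: strict_along_lsc.
have [d [[Q1 Q2] d0]] : exists d : R, (_ /\ _) /\ 0 < d :=
  filter_ex (filterI (filterI P1 P2) (nbhs_right_gt 0)).
exists d => // h Ah hd y.
have := Q1 y I h Ah; have := Q2 y I h Ah.
rewrite ltr_norml => H1 H2.
have : forall x, f x < h x + d /\ h x < f x + d.
  by move=> x; have := hd x; rewrite ltr_norml; lra.
move=> hd'; have {}H1 := H1 (fun x => (hd' x).1).
have {}H2 := H2 (fun x => (hd' x).2).
lra.
Qed.

End StrictContinuity.

(** * Extending increasing maps between dense subsets of the unit interval *)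

(** The extension is [m t = sup {b i | a i <= t}]. Density of the values of [a]
    makes it strictly increasing, density of the values of [b] makes it onto, and
    an increasing surjection between segments is continuous. The indexed form
    avoids having to choose a function from values of [a] to values of [b]. *)
Lemma dense_order_extension (R : realType) (T : Type) (P : set T)
    (a b : T -> R) :
  (forall i, P i -> 0 <= a i <= 1) -> (forall i, P i -> 0 <= b i <= 1) ->
  (exists i, [/\ P i, a i = 0 & b i = 0]) ->
  (exists i, [/\ P i, a i = 1 & b i = 1]) ->
  (forall s t, 0 <= s -> s < t -> t <= 1 -> exists i, P i /\ s < a i < t) ->
  (forall s t, 0 <= s -> s < t -> t <= 1 -> exists i, P i /\ s < b i < t) ->
  (forall i j, P i -> P j -> (b i < b j) = (a i < a j)) ->
  exists m, increasing_bijection_I m /\ forall i, P i -> b i = m (a i).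
Proof.
move=> a01 b01 [i0 [Pi0 a0 b0]] [i1 [Pi1 a1 b1]] da db ab.
have abW i j : P i -> P j -> (b i <= b j) = (a i <= a j).
  by move=> Pi Pj; rewrite !leNgt ab.
pose S t := [set b i | i in [set i | P i /\ a i <= t]].
pose m t := sup (S t).
have S0 t : 0 <= t -> S t !=set0 by move=> t0; exists 0, i0 => //=; rewrite a0.
have Sb t : has_ubound (S t).
  by exists 1 => _ [i [/b01/andP[_ +] _] <-].
have mge t i : P i -> a i <= t -> b i <= m t.
  by move=> Pi at_; apply: ub_le_sup => //; exists i.
have mle t c : 0 <= t -> (forall i, P i -> a i <= t -> b i <= c) -> m t <= c.
  by move=> t0 h; apply: ge_sup; [exact: S0|move=> _ [i [Pi it] <-]; exact: h].
have mE i : P i -> b i = m (a i).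
  move=> Pi; apply/eqP; rewrite eq_le mge //= mle //.
    by have /andP[] := a01 _ Pi.
  by move=> j Pj; rewrite abW.
have m01 t : 0 <= t <= 1 -> 0 <= m t <= 1.
  move=> /andP[t0 t1]; rewrite -{1}b0 mge ?a0 //= mle // => i Pi _.
  by have /andP[] := b01 _ Pi.
have mlt : {in `[0 : R, 1] &, {homo m : s t / s < t}}.
  move=> s t; rewrite !in_itv /= => /andP[s0 s1] /andP[t0 t1] st.
  have [i [Pi /andP[si it]]] := da _ _ s0 st t1.
  have [j [Pj /andP[ij jt]]] := da _ _ (le_trans s0 (ltW si)) it t1.
  apply: (@le_lt_trans _ _ (b i)).
    by apply: mle => // k Pk ks; rewrite abW // (le_trans ks) // ltW.
  by apply: (@lt_le_trans _ _ (b j)); [rewrite ab|apply: mge => //; exact: ltW].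
have mle_mono : {in `[0 : R, 1] &, {mono m : s t / s <= t}} := le_mono_in mlt.
have msurj : set_surj `[0, 1] `[0, 1] m.
  move=> u; rewrite /= in_itv /= => /andP[u0 u1].
  (* the inverse of [m] is given by the same formula with [a] and [b] exchanged *)
  pose t := sup [set a i | i in [set i | P i /\ b i <= u]].
  have ubt i : P i -> b i <= u -> a i <= t.
    move=> Pi iu; apply: ub_le_sup; last by exists i.
    by exists 1 => _ [j [/a01/andP[_ +] _] <-].
  have tle c : (forall i, P i -> b i <= u -> a i <= c) -> t <= c.
    move=> h; apply: ge_sup; last by move=> _ [i [Pi iu] <-]; exact: h.
    by exists 0, i0 => //=; rewrite b0.
  have t0 : 0 <= t by rewrite -a0 ubt // b0.
  have t1 : t <= 1 by apply: tle => i /a01/andP[].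
  exists t; first by rewrite /= in_itv /= t0.
  have /andP[mt0 mt1] : 0 <= m t <= 1 by apply: m01; rewrite t0.
  apply/eqP; rewrite eq_le; apply/andP; split; rewrite leNgt; apply/negP => h.
    have [i [Pi /andP[ui im]]] := db _ _ u0 h mt1.
    move: im; apply/negP; rewrite -leNgt; apply: mle => // j Pj jt.
    rewrite abW //; apply: le_trans jt _; apply: tle => k Pk ku.
    by rewrite -abW //; exact: le_trans ku (ltW ui).
  have [i [Pi /andP[mi iu]]] := db _ _ mt0 h u1.
  by move: mi; apply/negP; rewrite -leNgt; apply: mge => //; apply: ubt => //; exact: ltW.
exists m; split=> //; split=> //; first split.
- by move=> t; rewrite /= !in_itv /=; exact: m01.
- by move=> s t; rewrite !inE; exact: (inc_inj_in mle_mono).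
- exact: msurj.
- apply: segment_inc_surj_continuous => //.
  have m0 : m 0 = 0 by have := mE _ Pi0; rewrite a0 b0.
  have m1 : m 1 = 1 by have := mE _ Pi1; rewrite a1 b1.
  by rewrite m0 m1.
Qed.

(** * The equivalence *)

Theorem corollary2p15 (R : realType) (X Y : topologicalType)
    (cptX : compact [set: X]) (hX : hausdorff_space X)
    (cptY : compact [set: Y]) (hY : hausdorff_space Y)
    (A : set (X -> R)) (B : set (Y -> R))
    (latA : sublattice A) (latB : sublattice B)
    (mulA : mul_closed A) (mulB : mul_closed B)
    (uryA : urysohn_property A) (uryB : urysohn_property B)
    (denseA : dense_evaluation A) (denseB : dense_evaluation B)
    (phi : (X -> R) -> (Y -> R)) (isophi : lattice_isomorphism A B phi) :
  let i := uniform_homeomorphism A B phi in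
  let ii := forall f g : X -> R, A f -> A g ->
    ((forall x, f x < g x) <-> (forall y, phi f y < phi g y)) in
  let iii := exists (mu : Y -> X) (m : Y -> R -> R),
    [/\ homeomorphism mu,
        forall y, increasing_bijection_I (m y) &
        forall f y, A f -> phi f y = m y (f (mu y))] in
  (i <-> ii) /\ (ii <-> iii).
Proof.
move=> i ii iii.
have sepA : separating_lattice A by [].
have sepB : separating_lattice B by [].
have [psi iso] := lattice_isomorphism_inverse latA latB isophi.
have isoV := inverse_lattice_isos_sym iso.
have [mu locphi] := iso_local sepA sepB iso.
have [nu locpsi] := iso_local sepB sepA isoV.
have muK := local_along_cancel sepA sepB iso locphi locpsi.
have nuK := local_along_cancel sepB sepA isoV locpsi locphi.
pose strict := strict_along A phi mu /\ strict_along B psi nu.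
have strict_i : strict -> i.
  move=> [strphi strpsi]; split; first by case: isophi.
  exists psi; split; first exact: iso_cancel iso.
    apply/within_uniform_continuousP.
    exact: strict_along_sup_continuous locphi locpsi strphi strpsi denseB.
  apply/within_uniform_continuousP.
  exact: strict_along_sup_continuous locpsi locphi strpsi strphi denseA.
have i_strict : i -> strict.
  move=> [_ [psi' [psi'K /within_uniform_continuousP cphi
                        /within_uniform_continuousP cpsi']]].
  (* the continuous inverse need not agree with [psi] outside [B] *)
  have psi'E g : B g -> psi' g = psi g.
    move=> Bg; rewrite -{1}(iso_cancelV iso Bg) psi'K //.
    exact: iso_preimage iso _ _.
  have cpsi : sup_continuous_on B psi.
    move=> f Bf e e0; have [d d0 dP] := cpsi' f Bf e e0.
    by exists d => // h Bh hd; rewrite -!psi'E //; exact: dP.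
  split; first exact: strict_along_of_sup_continuous locphi locpsi cpsi.
  exact: strict_along_of_sup_continuous locpsi locphi cphi.
have ii_strict : ii -> strict.
  move=> hii; split.
    apply: (strict_along_of_increasing sepA locphi) => f g Af Ag.
    exact: (hii f g Af Ag).1.
  apply: (strict_along_of_increasing sepB locpsi) => f g Bf Bg fg.
  apply: (hii _ _ (iso_preimage iso Bf) (iso_preimage iso Bg)).2.
  by rewrite !(iso_cancelV iso).
have strict_iii : strict -> iii.
  move=> [strphi strpsi].
  have mP y : exists m, increasing_bijection_I m /\
      forall f, A f -> phi f y = m (f (mu y)).
    apply: (@dense_order_extension R (X -> R) A (fun f => f (mu y))
              (fun f => phi f y)).
    - by move=> f Af; rewrite (sep_ge0 sepA) // (sep_le1 sepA).
    - move=> f Af; have Bf := iso_image iso Af.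
      by rewrite (sep_ge0 sepB) // (sep_le1 sepB).
    - exists (cst 0); split=> //; first exact: sep_cst0.
      exact: (iso_cst0 sepA sepB iso).
    - exists (cst 1); split=> //; first exact: sep_cst1.
      exact: (iso_cst1 sepA sepB iso).
    - by move=> s t; exact: dense_between.
    - move=> s t s0 st t1.
      have [g [Bg gst]] := dense_between y denseB s0 st t1.
      exists (psi g); split; first exact: iso_preimage iso _ _.
      by rewrite (iso_cancelV iso).
    - move=> f g Af Ag.
      exact: (strict_along_lt sepA sepB iso locphi locpsi).
  have [m mE] := choice mP.
  exists mu, m; split=> [|y|f y]; [|exact: (mE y).1|exact: (mE y).2].
  exists nu; split=> //.
    exact: (local_along_continuous sepA sepB iso locphi).
  exact: (local_along_continuous sepB sepA isoV locpsi).
have iii_ii : iii -> ii.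
  move=> [h [m [[k [_ kK _ _]] mI phiE]]] f g Af Ag.
  have I01 (u : X -> R) x : A u -> u x \in `[0, 1].
    by move=> Au; rewrite in_itv /= (sep_ge0 sepA) // (sep_le1 sepA).
  split=> [fg y|fg x].
    by rewrite !phiE //; have [_ mlt _] := mI y; apply: mlt => //; exact: I01.
  have := fg (k x); rewrite !phiE // kK.
  have [_ mlt _] := mI (k x).
  by rewrite (leW_mono_in (le_mono_in mlt)) //; exact: I01.
split; split.
- by move=> /i_strict/strict_iii/iii_ii.
- by move=> /ii_strict/strict_i.
- by move=> /ii_strict/strict_iii.
- exact: iii_ii.
Qed.
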